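(* Let $\mathbf{C}$ be a class of commutative monoids closed under unions of chains, and let $M$ be a simple commutative monoid belonging to $\mathbf{C}$. Then: (1) $M$ admits an order-embedding into some simply $\mathbf{C}$-closed element of $\mathbf{C}$; (2) $M$ admits a unitary embedding into some simply $\mathbf{C}$-unitarily closed element of $\mathbf{C}$; (3) $M$ admits a strong unitary embedding into some simply $\mathbf{C}$-strongly unitarily closed element of $\mathbf{C}$.
   Context: Commutative monoids are written additively. The algebraic preordering of a commutative monoid $M$ is $x\le y\iff(\exists z\in M)(x+z=y)$. An order-unit of $M$ is $u\in M$ such that every $x\in M$ satisfies $x\le nu$ for some positive integer $n$. $M$ is simple if every $u\in M$ with $u\not\le 0$ is an order-unit of $M$. ''Closed under unions of chains'': the union of any nonempty family of members of $\mathbf{C}$ totally ordered by the relation ''is a submonoid of'' belongs to $\mathbf{C}$. An order-embedding $f:M\to N$ is an injective monoid homomorphism with $x\le y\iff f(x)\le f(y)$ for the algebraic preorderings. A homomorphism $f:A\to B$ is unitary if it is one-to-one, has cofinal image (every $b\in B$ satisfies $b\le f(a)$ for some $a\in A$), and for all $a_0,a_1\in A$, $b\in B$, $f(a_0)+b=f(a_1)$ implies $b\in f[A]$. It is strongly unitary if it is unitary and for all $m\in\mathbb{N}=\{1,2,\dots\}$ and $b\in B$, $mb\in f[A]$ implies $b\in f[A]$. If $A$ is a submonoid of $B$, then $B$ is an extension (resp. unitary extension, strong unitary extension) of $A$ if the inclusion map is an order-embedding (resp. unitary, strongly unitary). An equation system with parameters from $M$ is a finite set of equations, each of the form $\sum_{i<k}p_i\mathbf{x}_i+a=\sum_{i<k}q_i\mathbf{x}_i+b$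 with $k,p_i,q_i$ non-negative integers, $a,b\in M$, and $\mathbf{x}_i$ unknowns. A simple element $M$ of $\mathbf{C}$ is simply $\mathbf{C}$-closed (resp. simply $\mathbf{C}$-unitarily closed, simply $\mathbf{C}$-strongly unitarily closed) if every equation system with parameters from $M$ that has a solution in some extension (resp. unitary extension, strong unitary extension) of $M$ that is simple and belongs to $\mathbf{C}$ has a solution in $M$. *)

(* Defs.v *)
From Stdlib Require List.
From mathcomp Require Import all_boot ssralg.
From mathcomp Require Import classical_sets.

Set Implicit Arguments.
Unset Strict Implicit.
Unset Printing Implicit Defensive.

Import GRing.Theory.

Local Open Scope classical_set_scope.
Local Open Scope ring_scope.

Definition alg_le (M : nmodType) (x y : M) : Prop := exists z : M, x + z = y.

Definition order_unit (M : nmodType) (u : M) : Prop :=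
  forall x : M, exists2 n : nat, (0 < n)%N & alg_le x (u *+ n).

Definition simple_monoid (M : nmodType) : Prop :=
  forall u : M, ~ alg_le u 0 -> order_unit u.

(* A submonoid of B is rendered by an injective homomorphism f : A -> B, so
   "B is an extension of A" becomes "f is an order-embedding", and likewise
   for the (strong) unitary extensions. *)

Definition order_embedding (A B : nmodType) (f : {additive A -> B}) : Prop :=
  injective f /\ (forall x y : A, alg_le x y <-> alg_le (f x) (f y)).

Definition unitary (A B : nmodType) (f : {additive A -> B}) : Prop :=
  [/\ injective f,
      forall b : B, exists a : A, alg_le b (f a) &
      forall (a0 a1 : A) (b : B), f a0 + b = f a1 -> range f b].

Definition strongly_unitary (A B : nmodType) (f : {additive A -> B}) : Prop :=
  unitary f /\
  (forall (m : nat) (b : B), (0 < m)%N -> range f (b *+ m) -> range f b).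

(* U is the union of a nonempty chain of members of C: the members are
   submonoids of U via the injections g i, and "M i is a submonoid of M j"
   is the inclusion of their images in U. As structures on types are only
   compared up to isomorphism, the one-member chains make such a class closed
   under isomorphism (and independent of the choiceType part of nmodType). *)
Definition closed_under_chain_unions (C : nmodType -> Prop) : Prop :=
  forall (I : Type) (M : I -> nmodType) (U : nmodType)
         (g : forall i : I, {additive M i -> U}),
    inhabited I ->
    (forall i : I, C (M i)) ->
    (forall i : I, injective (g i)) ->
    (forall i j : I,
        range (g i) `<=` range (g j) \/ range (g j) `<=` range (g i)) ->
    \bigcup_i range (g i) = setT ->
    C U.

(* \sum_(i < nvars) lcoef i * x_i + lparam
     = \sum_(i < nvars) rcoef i * x_i + rparam *)
Record equation (M : nmodType) : Type := Equation {
  nvars : nat;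
  lcoef : 'I_nvars -> nat;
  rcoef : 'I_nvars -> nat;
  lparam : M;
  rparam : M
}.

Definition equation_system (M : nmodType) : Type := seq (equation M).

(* The unknowns x_0, x_1, ... are shared by all the equations of a system;
   the parameters are transported to B along f. *)
Definition satisfies (M B : nmodType) (f : M -> B) (x : nat -> B)
    (e : equation M) : Prop :=
  \sum_(i < nvars e) x i *+ lcoef i + f (lparam e)
    = \sum_(i < nvars e) x i *+ rcoef i + f (rparam e).

Definition solvable (M B : nmodType) (f : M -> B) (S : equation_system M) :
    Prop :=
  exists x : nat -> B, List.Forall (satisfies f x) S.

Definition simply_closed_for
    (E : forall A B : nmodType, {additive A -> B} -> Prop)
    (C : nmodType -> Prop) (M : nmodType) : Prop :=
  [/\ C M,
      simple_monoid M &
      forall S : equation_system M,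
        (exists (B : nmodType) (f : {additive M -> B}),
            [/\ E M B f, simple_monoid B, C B & solvable f S]) ->
        solvable (@idfun M) S].

Definition simply_closed := simply_closed_for (@order_embedding).
Definition simply_unitarily_closed := simply_closed_for (@unitary).
Definition simply_strongly_unitarily_closed :=
  simply_closed_for (@strongly_unitary).

(* Main.v *)
From HB Require Import structures.
From Stdlib Require Import Eqdep.
Require Import Defs.
From mathcomp Require Import all_boot ssralg.
From mathcomp Require Import boolp classical_sets.
From mathcomp Require wochoice.

(** All three notions of embedding compose and can be tested locally on a
    directed union, which is all the argument uses. Given M, go through the
    equation systems over M along a well-ordering; at each one, if some simple
    extension in C of the current monoid solves it, pass to such an extension,
    otherwise do nothing, taking unions at limit steps. In the resulting
    extension M' every system over M that is solvable in some further extension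
    is already solvable. Iterating M, M', M'', ... and taking the union gives
    the closed monoid, since a finite system has its parameters in one term.

    Extensions chosen along the way have no common bound on their size, so the
    carriers are made concrete by injections into a large W-type in which every
    small family leaves room. Extensions then become code-preserving maps, which
    are unique, so that transfinite chains are automatically coherent. *)

Set Implicit Arguments.
Unset Strict Implicit.
Unset Printing Implicit Defensive.

Import GRing.Theory.

Local Open Scope classical_set_scope.
Local Open Scope ring_scope.

(** * Recursion along a well-ordering *)

Section TransfiniteSaturation.

Lemma wf_strict_well_order (T : eqType) (R : rel T) :
  wochoice.well_order R -> well_founded (fun s t => ~~ R t s).
Proof.
move=> Rwo; apply: contrapT => nwf.
have [x nx] : exists x, ~ Acc (fun s t => ~~ R t s) x.
  by apply/existsNP => allacc; apply: nwf.
have [|z [[+ zmin] _]] := Rwo [pred x | ~~ `[< Acc (fun s t => ~~ R t s) x >]].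
  by exists x; rewrite inE; apply/asboolPn.
rewrite inE => /asboolPn; apply; constructor => y nRzy.
apply: contrapT => nacc; move/negP: nRzy; apply; apply: zmin.
by rewrite inE; apply/asboolPn.
Qed.

Lemma strict_well_order_total (T : eqType) (R : rel T) (s t : T) :
  wochoice.well_order R -> s <> t -> ~~ R s t \/ ~~ R t s.
Proof.
move=> Rwo st.
have Rxx x : R x x.
  have [|z [[+ zmin] _]] := Rwo (pred1 x); first by exists x; rewrite inE.
  by rewrite inE => /eqP zx; rewrite -{1}zx zmin// inE.
have [Rst|] := boolP (R s t); last by left.
have [Rts|] := boolP (R t s); last by right.
(* Otherwise both [s] and [t] are least in the pair, against uniqueness. *)
have [|z [_ zuniq]] := Rwo (pred2 s t); first by exists s; rewrite !inE eqxx.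
case: st; rewrite -(zuniq s) ?(zuniq t) //; split; rewrite ?inE ?eqxx ?orbT//.
all: by move=> x; rewrite !inE => /orP[] /eqP->.
Qed.

(* X may live in a larger universe than T and the index types I, where Zorn's
   lemma of the library is not available; hence the recursion along T. *)
Lemma transfinite_saturation (T X : Type) (le : X -> X -> Prop)
    (D : T -> X -> Prop) (a : X) :
  (forall x, le x x) ->
  (forall x y z, le x y -> le y z -> le x z) ->
  (forall (I : Type) (F : I -> X), inhabited I ->
     (forall i j, le (F i) (F j) \/ le (F j) (F i)) ->
     exists y, forall i, le (F i) y) ->
  (forall t x y, le x y -> D t x -> D t y) ->
  (forall t x, exists2 y, le x y & D t y) ->
  exists2 y, le a y & forall t, D t y.
Proof.
move=> lexx le_trans ub Dle Dex.
have [R Rwo] := wochoice.well_ordering_principle {classic T}.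
pose lt (s t : T) : Prop := ~~ R t s.
have lt_wf : well_founded lt by exact: (@wf_strict_well_order {classic T} R).
(* What is needed of the earlier values is a premise inside the existential, so that [step] applies
   to every [F] and can drive the recursion; [FP] discharges these premises by induction. *)
have step s (F : forall t, lt t s -> X) : exists y,
    (forall t p, le a (F t p)) ->
    (forall t p t' p', le (F t p) (F t' p') \/ le (F t' p') (F t p)) ->
    [/\ le a y, forall t p, le (F t p) y & D s y].
  have [aF|] := pselect (forall t p, le a (F t p)); last by exists a.
  have [FF|] := pselect (forall t p t' p',
    le (F t p) (F t' p') \/ le (F t' p') (F t p)); last by exists a.
  (* [None] contributes [a]: the family is nonempty and its bound lies above [a] even at the first
     index. *)
  pose G (o : option {t | lt t s}) :=
    if o is Some (exist t p) then F t p else a.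
  have [||y Gy] := ub _ G; first exact: (inhabits None).
    move=> [[t p]|] [[t' p']|] /=; first exact: FF.
    - by right; apply: aF.
    - by left; apply: aF.
    - by left.
  have [z yz Dz] := Dex s y; exists z => _ _; split => //.
    exact: le_trans (Gy None) yz.
  by move=> t p; apply: le_trans (Gy (Some (exist _ t p))) yz.
pose F := Fix lt_wf (fun=> X) (fun s G => sval (cid (step s G))).
have FE s : F s = sval (cid (step s (fun t _ => F t))).
  rewrite /F Fix_eq// => x f g fg.
  have -> // : f = g.
  by apply: functional_extensionality_dep => t; apply: funext => p.
have chain (P : T -> Prop) :
    (forall s, P s -> forall t, lt t s -> le (F t) (F s)) ->
    forall s t, P s -> P t -> le (F s) (F t) \/ le (F t) (F s).
  move=> FP s t Ps Pt; have [->|st] := pselect (s = t); first by left.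
  have [l|l] := @strict_well_order_total {classic T} _ _ _ Rwo st.
    by right; apply: FP.
  by left; apply: FP.
have FP s : [/\ le a (F s), forall t, lt t s -> le (F t) (F s) & D s (F s)].
  elim/(well_founded_ind lt_wf): s => s IH; rewrite FE.
  case: cid => y /=; apply=> [t /IH[]//|t p t' p'].
  by apply: (chain (lt^~ s)) => // ? /IH[].
have [| |y Fy] := ub _ (fun o => if o is Some t then F t else a).
- exact: (inhabits None).
- move=> [s|] [t|]; last by left.
  + by apply: (chain (fun=> True)) => // u _; have [] := FP u.
  + by right; have [] := FP s.
  + by left; have [] := FP t.
exists y; first exact: (Fy None).
by move=> t; apply: Dle (Fy (Some t)) _; have [] := FP t.
Qed.

End TransfiniteSaturation.

(** * Directed unions of monoids *)

Lemma kernel_quotient (S T : Type) (e : S -> T) :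
  exists (U : Type) (p : S -> U) (eU : U -> T),
    [/\ injective eU, forall s, eU (p s) = e s & forall u, exists s, p s = u].
Proof.
(* Representatives are used because the image of e need not be a small type. *)
pose rep s : S := sval (cid (ex_intro (fun r => e r = e s) s erefl)).
have eP s : e (rep s) = e s by rewrite /rep; case: cid.
have rep_eq s t : e s = e t -> rep s = rep t.
  move=> st; rewrite /rep; move: (ex_intro _ s _) (ex_intro _ t _).
  by rewrite st => p q; rewrite (Prop_irrelevance p q).
pose p s : {r | rep r = r} := exist _ (rep s) (rep_eq _ _ (eP s)).
exists {r | rep r = r}, p, (e \o sval); split=> //= [[r rr] [t tt] /=|[r rr]].
  by move=> /rep_eq; rewrite rr tt; apply: eq_exist.
by exists r; apply: eq_exist.
Qed.

Section DirectedUnion.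
Variables (I : Type) (N : I -> nmodType) (T : Type) (e : forall i, N i -> T).
Hypothesis I_inhabited : inhabited I.
Hypothesis e_inj : forall i, injective (@e i).
Hypothesis directed : forall i j, exists k,
  (exists h : {additive N i -> N k}, forall x, e (h x) = e x) /\
  (exists h : {additive N j -> N k}, forall x, e (h x) = e x).

(** The codes in [T] serve as the gluing relation: elements of different [N i] are identified
    exactly when their codes agree, which makes the maps [g i] compatible with all transition
    maps. *)
Lemma directed_union :
  exists (U : nmodType) (g : forall i, {additive N i -> U}) (eU : U -> T),
    [/\ injective eU, forall i x, eU (g i x) = e x
      & forall u, exists i x, g i x = u].
Proof.
have [U0 [p [eU [eU_inj pE p_surj]]]] :=
  kernel_quotient (fun s : {i & N i} => e (projT2 s)).
pose U : choiceType := {classic U0}.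
pose g i x : U := p (existT _ i x).
have gE i x : eU (g i x) = e x by rewrite pE.
have lift i j : exists k (f : {additive N i -> N k}) (h : {additive N j -> N k}),
    (forall x, g k (f x) = g i x) /\ (forall x, g k (h x) = g j x).
  have [k [[f fE] [h hE]]] := directed i j; exists k, f, h.
  by split=> x; apply: eU_inj; rewrite !gE.
have g_inj i : injective (g i).
  by move=> x y /(congr1 eU); rewrite !gE => /e_inj.
have cover1 u : exists i x, g i x = u.
  by have [[i x] <-] := p_surj u; exists i, x.
have cover2 u v : exists i x y, g i x = u /\ g i y = v.
  have [i [x <-]] := cover1 u; have [j [y <-]] := cover1 v.
  have [k [f [h [fE hE]]]] := lift i j.
  by exists k, (f x), (h y).
have cover3 u v w : exists i x y z, [/\ g i x = u, g i y = v & g i z = w].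
  have [i [x [y [<- <-]]]] := cover2 u v; have [j [z <-]] := cover1 w.
  have [k [f [h [fE hE]]]] := lift i j.
  by exists k, (f x), (f y), (h z).
(* Two pairs of representatives are compared at a common index, where injectivity makes them
   equal. *)
have addP u v : exists w, forall i x y,
    g i x = u -> g i y = v -> g i (x + y) = w.
  have [i [x [y [<- <-]]]] := cover2 u v; exists (g i (x + y)) => j x' y'.
  have [k [f [h [fE hE]]]] := lift i j.
  rewrite -!fE -!hE => /g_inj xx' /g_inj yy'.
  by rewrite !raddfD xx' yy'.
pose add u v := sval (cid (addP u v)).
have addE i x y : add (g i x) (g i y) = g i (x + y).
  by rewrite /add; case: cid => w /= /(_ i x y) ->.
have [i0] := I_inhabited.
have g0 i : g i 0 = g i0 0.
  have [k [f [h [fE hE]]]] := lift i i0.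
  by rewrite -fE -hE !raddf0.
have addA : associative add.
  move=> u v w; have [i [x [y [z [<- <- <-]]]]] := cover3 u v w.
  by rewrite !addE addrA.
have addC : commutative add.
  by move=> u v; have [i [x [y [<- <-]]]] := cover2 u v; rewrite !addE addrC.
have add0 : left_id (g i0 0) add.
  by move=> u; have [i [x <-]] := cover1 u; rewrite -(g0 i) addE add0r.
pose Um := GRing.isNmodule.Build U addA addC add0.
pose UN : nmodType := HB.pack U Um.
have gA i : nmod_morphism (g i : N i -> UN).
  by split=> [|x y]; [exact: g0|rewrite -addE].
pose gN i : {additive N i -> UN} :=
  HB.pack (g i : N i -> UN) (GRing.isNmodMorphism.Build _ _ _ (gA i)).
by exists UN, gN, eU.
Qed.

End DirectedUnion.

(** * Equation systems along homomorphisms *)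

Section SystemTransport.
Variables (A B : nmodType) (h : A -> B).

Definition map_equation (q : equation A) : equation B :=
  Equation (@lcoef _ q) (@rcoef _ q) (h (lparam q)) (h (rparam q)).

Definition map_system (S : equation_system A) : equation_system B :=
  [seq map_equation q | q <- S].

Lemma solvable_map_system (D : nmodType) (g : B -> D) (S : equation_system A) :
  solvable g (map_system S) <-> solvable (g \o h) S.
Proof.
by split=> -[x xS]; exists x; move: xS; elim: S => [|q S IH] //= xS;
  inversion_clear xS; constructor => //; apply: IH.
Qed.

End SystemTransport.

Lemma solvable_comp (A B D : nmodType) (f : A -> B) (g : {additive B -> D})
    (S : equation_system A) :
  solvable f S -> solvable (g \o f) S.
Proof.
move=> [x xS]; exists (g \o x); apply: List.Forall_impl xS => q /(congr1 g).
rewrite /satisfies !raddfD !raddf_sum /= => qx.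
under eq_bigr do rewrite -raddfMn.
by rewrite qx; congr (_ + _); apply: eq_bigr => i _; rewrite raddfMn.
Qed.

Lemma alg_le_raddf (A B : nmodType) (f : {additive A -> B}) (x y : A) :
  alg_le x y -> alg_le (f x) (f y).
Proof. by move=> [z <-]; exists (f z); rewrite raddfD. Qed.

Lemma alg_le_trans (A : nmodType) (x y z : A) :
  alg_le x y -> alg_le y z -> alg_le x z.
Proof. by move=> [u <-] [v <-]; exists (u + v); rewrite addrA. Qed.

Lemma alg_le_refl (A : nmodType) (x : A) : alg_le x x.
Proof. by exists 0; rewrite addr0. Qed.

(** * Embedding notions that compose and are local *)

Definition embedding_kind := forall A B : nmodType, {additive A -> B} -> Prop.

(** Testing one [u] at a time is enough because each condition to be checked involves a single
    element of the target beyond images from [A]; for order-embeddings this is the difference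
    witnessing an inequality. *)
Definition locally (E : embedding_kind) : embedding_kind := fun A U f =>
  forall u : U, exists (B : nmodType) (h : {additive A -> B})
    (g : {additive B -> U}),
    [/\ E A B h, injective g, forall x, g (h x) = f x & exists y, g y = u].

Record admissible (E : embedding_kind) : Prop := Admissible {
  adm_inj : forall (A B : nmodType) (f : {additive A -> B}), E A B f -> injective f;
  adm_id : forall A : nmodType, E A A idfun;
  adm_comp : forall (A B D : nmodType) (f : {additive A -> B})
    (g : {additive B -> D}), E A B f -> E B D g -> E A D (g \o f);
  adm_local : forall (A U : nmodType) (f : {additive A -> U}), locally E f -> E A U f
}.

Lemma locally_inj (E : embedding_kind) (A U : nmodType)
    (f : {additive A -> U}) :
  (forall (A B : nmodType) (f : {additive A -> B}), E A B f -> injective f) ->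
  locally E f -> injective f.
Proof.
move=> E_inj fE x y; have [B [h [g [hE g_inj gh _]]]] := fE 0.
by rewrite -!gh => /g_inj /(E_inj _ _ _ hE).
Qed.

Lemma order_embedding_admissible : admissible order_embedding.
Proof.
have E_inj (A B : nmodType) (f : {additive A -> B}) :
  order_embedding f -> injective f by case.
split=> // [A|A B D f g [fi fE] [gi gE]|A U f fE].
- by split.
- split=> [|x y]; first exact: inj_comp.
  by rewrite (fE x y) (gE (f x) (f y)).
split=> [|x y]; first exact: locally_inj fE.
split=> [|[u]]; first exact: alg_le_raddf.
have [B [h [g [[_ hE] g_inj gh [z <-]]]]] := fE u.
by rewrite -!gh -raddfD => /g_inj hz; apply/hE; exists z.
Qed.

Lemma unitary_inj (A B : nmodType) (f : {additive A -> B}) :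
  unitary f -> injective f.
Proof. by case. Qed.

Lemma unitary_id (A : nmodType) : unitary (@idfun A : {additive A -> A}).
Proof.
by split=> // b; exists b; apply: alg_le_refl.
Qed.

Lemma unitary_comp (A B D : nmodType) (f : {additive A -> B})
    (g : {additive B -> D}) :
  unitary f -> unitary g -> unitary (g \o f : {additive A -> D}).
Proof.
move=> [fi fc fu] [gi gc gu]; split=> [|d|a0 a1 d /= ad].
- exact: inj_comp.
- have [b db] := gc d; have [a ba] := fc b; exists a.
  exact: alg_le_trans db (alg_le_raddf g ba).
have [b _ bd] := gu _ _ _ ad; move: ad; rewrite -bd -raddfD => /gi /fu[a _ ab].
by exists a => //=; rewrite ab.
Qed.

Lemma unitary_local (A U : nmodType) (f : {additive A -> U}) :
  locally unitary f -> unitary f.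
Proof.
move=> fE; split=> [|u|a0 a1 u].
- exact: locally_inj unitary_inj fE.
- have [B [h [g [[_ hc _] g_inj gh [y <-]]]]] := fE u.
  by have [a ya] := hc y; exists a; rewrite -gh; apply: alg_le_raddf.
have [B [h [g [[_ _ hu] g_inj gh [y <-]]]]] := fE u.
by rewrite -!gh -raddfD => /g_inj /hu[a _ <-]; exists a.
Qed.

Lemma unitary_admissible : admissible unitary.
Proof.
split; [exact: unitary_inj|exact: unitary_id|exact: unitary_comp|].
exact: unitary_local.
Qed.

Lemma strongly_unitary_admissible : admissible strongly_unitary.
Proof.
split=> [A B f [/unitary_inj]//|A|A B D f g [fu fs] [gu gs]|A U f fE].
- by split; [exact: unitary_id|move=> m b _ _; exists b].
- split; first exact: unitary_comp.
  move=> m d m0 [a _ /= ad].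
  have [b _ bd] : range g d by apply: (gs m) => //; exists (f a).
  have [a' _ ab] : range f b.
    apply: (fs m) => //; exists a => //; apply: (unitary_inj gu).
    by rewrite ad -bd raddfMn.
  by exists a' => //=; rewrite ab.
split.
  apply: unitary_local => u; have [B [h [g [[hu _] *]]]] := fE u.
  by exists B, h, g.
move=> m u m0; have [B [h [g [[_ hs] g_inj gh [y <-]]]]] := fE u.
move=> [a _]; rewrite -gh -raddfMn => /g_inj hay.
by have [a' _ <-] : range h y; [apply: (hs m) => //; exists a|exists a'].
Qed.

(** * Codes for carriers *)

(* The child map e makes Node e b differ from every e a; the label b provides
   enough such nodes to code all of B. *)
Inductive univ : Type :=
  Node (A B : Type) (e : A -> univ) (b : B).

(** With equality, this tree would be its own child, but the child relation is well founded. *)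
Lemma Node_fresh (A B : Type) (e : A -> univ) (b : B) (a : A) :
  e a <> Node e b.
Proof.
pose child u v := let: Node A B e b := v in exists a, e a = u.
have child_wf : well_founded child.
  by elim=> A' B' e' IH b'; constructor => _ [a' <-].
suff irr v : ~ child v v.
  by move=> eab; apply: (irr (Node e b)); exists a.
by elim/(well_founded_ind child_wf): v => v IH vv; apply: (IH v vv vv).
Qed.

Lemma Node_inj (A B : Type) (e : A -> univ) :
  injective (@Node A B e).
Proof. by move=> b b' [bb']; apply: inj_pair2 bb'. Qed.

(** Points of the image keep their old code and any other [b] receives the fresh code [Node e b]. *)
Lemma code_extension (A B : Type) (e : A -> univ) (f : A -> B) :
  injective e -> injective f ->
  exists2 e' : B -> univ, injective e' & forall a, e' (f a) = e a.
Proof.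
move=> e_inj f_inj.
have codeP b : exists c, (exists2 a, f a = b & c = e a) \/
    (~ (exists a, f a = b)) /\ c = Node e b.
  have [[a <-]|nb] := pselect (exists a, f a = b).
    by exists (e a); left; exists a.
  by exists (Node e b); right.
pose e' b := sval (cid (codeP b)).
have e'P b : (exists2 a, f a = b & e' b = e a) \/
    (~ (exists a, f a = b)) /\ e' b = Node e b by exact: svalP (cid (codeP b)).
exists e' => [b b'|a].
  case: (e'P b) => [[a <- ->]|[_ ->]]; case: (e'P b') => [[a' <- ->]|[_ ->]].
  - by move=> /e_inj->.
  - by move=> eq_code; case: (Node_fresh eq_code).
  - by move=> /esym eq_code; case: (Node_fresh eq_code).
  - by move=> eq_code; apply: Node_inj eq_code.
have [[a' /f_inj -> ->] //|[[]]] := e'P (f a); by exists a.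
Qed.

(** * Coded simple members of the class, and the closure construction *)

Section Stages.
Variables (E : embedding_kind) (C : nmodType -> Prop).
Hypothesis E_adm : admissible E.
Hypothesis C_union : closed_under_chain_unions C.

Record stage : Type := Stage {
  carrier :> nmodType;
  code : carrier -> univ;
  code_inj : injective code;
  stage_class : C carrier;
  stage_simple : simple_monoid carrier
}.

Definition inclusion (P Q : stage) (h : {additive P -> Q}) : Prop :=
  forall x, code (h x) = code x.

Definition substage (P Q : stage) : Prop :=
  exists2 h : {additive P -> Q}, E h & inclusion h.

Lemma inclusion_unique (P Q : stage) (f g : {additive P -> Q}) :
  inclusion f -> inclusion g -> f =1 g.
Proof. by move=> fP gP x; apply: code_inj; rewrite fP gP. Qed.

Lemma substage_refl (P : stage) : substage P P.
Proof. by exists idfun; [exact: adm_id|]. Qed.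

Lemma substage_trans (P Q R : stage) :
  substage P Q -> substage Q R -> substage P R.
Proof.
move=> [f fE fP] [g gE gP]; exists (g \o f); first exact: adm_comp.
by move=> x; rewrite /= gP fP.
Qed.

Lemma stage_union (I : Type) (P : I -> stage) :
  inhabited I ->
  (forall i j, substage (P i) (P j) \/ substage (P j) (P i)) ->
  exists Q : stage, (forall i, substage (P i) Q) /\
    forall q : Q, exists i (p : P i), code p = code q.
Proof.
move=> I0 chain.
have directed i j : exists k, substage (P i) (P k) /\ substage (P j) (P k).
  have [ij|ji] := chain i j.
    by exists j; split=> //; apply: substage_refl.
  by exists i; split=> //; apply: substage_refl.
have [|i j|U [g [eU [eU_inj gE cover]]]] :=
    @directed_union I P univ (fun i => @code (P i)) I0.
- by move=> i; apply: code_inj.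
- have [k [[f _ fP] [h _ hP]]] := directed i j.
  by exists k; split; [exists f|exists h].
have g_inj i : injective (g i).
  by move=> x y /(congr1 eU); rewrite !gE => /code_inj.
have g_sub i j (h : {additive P i -> P j}) : inclusion h ->
    forall x, g j (h x) = g i x.
  by move=> hP x; apply: eU_inj; rewrite !gE.
(* Both [u] and [v] come from one [P k]; there [u] is still not below 0, since homomorphisms
   preserve the preordering. *)
have U_simple : simple_monoid U.
  move=> u u0 v; have [i [x xu]] := cover u; have [j [y yv]] := cover v.
  have [k [[f _ fP] [h _ hP]]] := directed i j.
  have [|n n0 le_yx] := @stage_simple (P k) (f x) _ (h y).
    by move=> /(alg_le_raddf (g k)); rewrite raddf0 (g_sub _ _ _ fP) xu.
  exists n => //; move: le_yx => /(alg_le_raddf (g k)).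
  by rewrite raddfMn (g_sub _ _ _ fP) (g_sub _ _ _ hP) xu yv.
have U_class : C U.
  apply: (C_union (M := P) (g := g)) => //.
  - by move=> i; apply: stage_class.
  - move=> i j; have [[h _ hP]|[h _ hP]] := chain i j; [left|right].
      by move=> _ [x _ <-]; exists (h x) => //; rewrite (g_sub _ _ _ hP).
    by move=> _ [x _ <-]; exists (h x) => //; rewrite (g_sub _ _ _ hP).
  - apply/seteqP; split=> // u _; have [i [x <-]] := cover u.
    by exists i => //; exists x.
exists (Stage eU_inj U_class U_simple); split=> [i|q].
  exists (g i); last by move=> x; rewrite /= gE.
  apply: adm_local => // u; have [j [y yu]] := cover u.
  have [k [[f fE fP] [h hE hP]]] := directed i j.
  exists (P k), f, (g k); split=> // [x|]; first exact: g_sub.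
  by exists (h y); rewrite (g_sub _ _ _ hP).
by have [i [x <-]] := cover q; exists i, x; rewrite /= gE.
Qed.

(** Only codes are added, the carrier of [Q] being [B] itself; thus arbitrary simple extensions in
    [C] are reached by quantifying over stages. *)
Lemma stage_extension (P : stage) (B : nmodType) (f : {additive P -> B}) :
  E f -> simple_monoid B -> C B ->
  exists (Q : stage) (i : {additive P -> Q}) (j : {additive B -> Q}),
    [/\ E i, inclusion i & forall x, j (f x) = i x].
Proof.
move=> fE B_simple B_class.
have [e e_inj eP] := code_extension (@code_inj P) (adm_inj E_adm fE).
by exists (Stage e_inj B_class B_simple), f, idfun.
Qed.

(** The system stays over [A] while [Q] grows; the inclusion is unique, so the choice of [h] is
    immaterial. *)
Definition solved_in (A : stage) (S : equation_system A) (Q : stage) : Prop :=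
  exists2 h : {additive A -> Q}, inclusion h & solvable h S.

(** A system that no later stage solves is also decided; hence every stage has a later one deciding
    a given system, and decisions persist. *)
Definition decided_in (A : stage) (S : equation_system A) (Q : stage) : Prop :=
  forall R, substage Q R -> solved_in S R -> solved_in S Q.

Lemma solved_in_mono (A : stage) (S : equation_system A) (Q R : stage) :
  substage Q R -> solved_in S Q -> solved_in S R.
Proof.
move=> [g _ gP] [h hP hS]; exists (g \o h); last exact: solvable_comp.
by move=> x; rewrite /= gP hP.
Qed.

Lemma decided_in_mono (A : stage) (S : equation_system A) (Q R : stage) :
  substage Q R -> decided_in S Q -> decided_in S R.
Proof.
move=> QR SQ R' RR' SR'; apply: (solved_in_mono QR); apply: SQ SR'.
exact: substage_trans QR RR'.
Qed.

Lemma decided_in_ex (A : stage) (S : equation_system A) (Q : stage) :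
  exists2 R, substage Q R & decided_in S R.
Proof.
have [[R QR SR]|nS] := pselect (exists2 R, substage Q R & solved_in S R).
  by exists R.
exists Q; first exact: substage_refl.
by move=> R QR SR; case: nS; exists R.
Qed.

Lemma decide_all (A : stage) :
  exists2 Q, substage A Q & forall S : equation_system A, decided_in S Q.
Proof.
apply: (transfinite_saturation (le := substage)).
- exact: substage_refl.
- exact: substage_trans.
- move=> I P I0 chain; have [Q [PQ _]] := stage_union I0 chain.
  by exists Q.
- exact: decided_in_mono.
- exact: decided_in_ex.
Qed.

Lemma system_from_stage (P : nat -> stage) (N : stage)
    (g : forall n, {additive P n -> N}) (S : equation_system N) :
  (forall u : N, exists n, forall m, (n <= m)%N -> exists x, g m x = u) ->
  exists n (S' : equation_system (P n)), map_system (g n) S' = S.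
Proof.
move=> cover.
(* The induction carries all [m] beyond [n], so that the bounds for the parameters can be combined
   by a maximum. *)
suff [n /(_ n (leqnn n)) [S' <-]] : exists n, forall m, (n <= m)%N ->
  exists S', map_system (g m) S' = S by exists n, S'.
elim: S => [|[k l r a b] S [n nS]]; first by exists 0%N => m _; exists [::].
have [na aP] := cover a; have [nb bP] := cover b.
exists (maxn n (maxn na nb)) => m; rewrite !geq_max => /and3P[nm nam nbm].
have [S' <-] := nS m nm; have [a' <-] := aP m nam; have [b' <-] := bP m nbm.
by exists (Equation l r a' b' :: S').
Qed.

Lemma closed_stage (A : stage) :
  exists2 N : stage, substage A N &
    forall (S : equation_system N), decided_in S N.
Proof.
pose next P := sval (cid2 (decide_all P)).
have nextP P : substage P (next P) /\
    forall S : equation_system P, decided_in S (next P).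
  by rewrite /next; case: cid2.
pose P n := iter n next A.
have Pmono m n : (m <= n)%N -> substage (P m) (P n).
  move=> /subnK <-; elim: (n - m)%N => [|k IH]; first exact: substage_refl.
  exact: substage_trans IH (nextP _).1.
have [||N [PN cover]] := @stage_union nat P; first exact: (inhabits 0%N).
  by move=> m n; have [/Pmono|/ltnW/Pmono] := leqP m n; [left|right].
exists N; first exact: (PN 0%N).
move=> S R NR [f fP fS].
have inclP n : exists h : {additive P n -> N}, inclusion h.
  by have [h _ hP] := PN n; exists h.
pose g n := sval (cid (inclP n)).
have gP n : inclusion (g n) by rewrite /g; case: cid.
have [u|n [S' S'S]] := system_from_stage (g := g) S.
  have [n [p pu]] := cover u; exists n => m nm.
  have [h _ hP] := Pmono _ _ nm; exists (h p); apply: code_inj.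
  by rewrite gP -pu; apply: hP.
have S'R : solved_in S' R.
  exists (f \o g n); first by move=> x; rewrite /= fP gP.
  by apply/solvable_map_system; rewrite S'S.
(* Systems over [P n] are decided at the next step, and [R] lies above it through [N]. *)
have [h hP hS'] : solved_in S' (P n.+1).
  apply: ((nextP (P n)).2 S' R) => //.
  exact: substage_trans (PN n.+1) NR.
exists idfun => //; rewrite -S'S; apply/solvable_map_system.
have -> : idfun \o g n = g n.+1 \o h.
  apply: funext => x; apply: code_inj.
  exact: etrans (gP n x) (esym (etrans (gP n.+1 (h x)) (hP x))).
exact: solvable_comp.
Qed.

Lemma closed_embedding (M : nmodType) :
  simple_monoid M -> C M ->
  exists (N : nmodType) (f : {additive M -> N}),
    E f /\ simply_closed_for (@E) C N.
Proof.
move=> M_simple M_class.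
(* The initial codes are childless nodes labelled by the elements of [M]. *)
have M_inj : injective (@Node False M (fun x => match x with end)).
  exact: Node_inj.
have [N [f fE _] N_decided] := closed_stage (Stage M_inj M_class M_simple).
exists N, f; split=> //; split; [exact: stage_class|exact: stage_simple|].
move=> S [B [h [hE B_simple B_class hS]]].
have [Q [i [j [iE iP jP]]]] := stage_extension hE B_simple B_class.
have [|k kP kS] := N_decided S Q (ex_intro2 _ _ i iE iP).
  exists i => //; rewrite (_ : GRing.Additive.sort i = j \o h).
    exact: solvable_comp.
  by apply: funext => x; rewrite /= jP.
(* The solution was found along some inclusion of [N] in itself, which uniqueness forces to be the
   identity. *)
rewrite (_ : @idfun N = k) //.
exact/funext/inclusion_unique.
Qed.

End Stages.

Theorem proposition2p5 (C : nmodType -> Prop)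
    (hC : closed_under_chain_unions C)
    (M : nmodType) (hM : simple_monoid M) (hCM : C M) :
  (exists (N : nmodType) (f : {additive M -> N}),
      order_embedding f /\ simply_closed C N) /\
  (exists (N : nmodType) (f : {additive M -> N}),
      unitary f /\ simply_unitarily_closed C N) /\
  (exists (N : nmodType) (f : {additive M -> N}),
      strongly_unitary f /\ simply_strongly_unitarily_closed C N).
Proof.
split; [|split].
- exact: (closed_embedding order_embedding_admissible hC hM hCM).
- exact: (closed_embedding unitary_admissible hC hM hCM).
- exact: (closed_embedding strongly_unitary_admissible hC hM hCM).
Qed.
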